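(* Let $G_1$ be a pancyclic graph of odd order, and let $G_2$ be a semi-Hamiltonian graph. Then the Cartesian product $G_1\times G_2$ is pancyclic.
   Context: All graphs are finite, simple and undirected. The order of a graph is its number of vertices. A graph of order $n\ge 3$ is pancyclic if it contains a $k$-cycle as a (not necessarily induced) subgraph for every $k\in\{3,4,\ldots,n\}$. A graph of order $v$ is semi-Hamiltonian if it has a subgraph isomorphic to the path $P_v$ on $v$ vertices (a Hamiltonian path); in particular, a graph with a Hamiltonian cycle is also semi-Hamiltonian. For graphs $G_1,G_2$ with vertex sets $V_1,V_2$, the Cartesian product $G_1\times G_2$ has vertex set $V_1\times V_2$, and $(u_1,u_2)$ and $(v_1,v_2)$ are adjacent if and only if either $u_1=v_1$ and $u_2$ is adjacent to $v_2$ in $G_2$, or $u_1$ is adjacent to $v_1$ in $G_1$ and $u_2=v_2$. *)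

(* Defs.v *)
From mathcomp Require Import all_boot.

Set Implicit Arguments.
Unset Strict Implicit.
Unset Printing Implicit Defensive.

Record sgraph : Type := SGraph {
  vertex :> finType;
  adj : rel vertex;
  adj_sym : symmetric adj;
  adj_irrefl : irreflexive adj
}.

Definition graph_order (G : sgraph) : nat := #|G|.

(* The bound [3 <= k] matters: for [k <= 2], [ucycle] accepts the empty
   sequence and the back-and-forth walk along an edge. *)
Definition has_cycle (G : sgraph) (k : nat) : Prop :=
  3 <= k /\ exists c : seq G, ucycle (@adj G) c /\ size c = k.

Definition pancyclic (G : sgraph) : Prop :=
  3 <= graph_order G /\ forall k : nat, 3 <= k <= graph_order G -> has_cycle G k.

(* The path is given as a first vertex [x] followed by [p], so a
   semi-Hamiltonian graph has at least one vertex. *)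
Definition semi_hamiltonian (G : sgraph) : Prop :=
  exists (x : G) (p : seq G),
    [/\ path (@adj G) x p, uniq (x :: p) & size (x :: p) = graph_order G].

Section CartesianProduct.

Variables G1 G2 : sgraph.

Definition cart_adj : rel (G1 * G2) := fun u v =>
  (u.1 == v.1) && adj u.2 v.2 || adj u.1 v.1 && (u.2 == v.2).

Lemma cart_adj_sym : symmetric cart_adj.
Proof.
move=> u v; rewrite /cart_adj (eq_sym u.1) (eq_sym u.2).
by rewrite (adj_sym u.1) (adj_sym u.2).
Qed.

Lemma cart_adj_irrefl : irreflexive cart_adj.
Proof. by move=> u; rewrite /cart_adj !adj_irrefl andbF. Qed.

Definition cart_prod : sgraph := SGraph cart_adj_sym cart_adj_irrefl.

End CartesianProduct.

(* Main.v *)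
Require Import Defs.
From mathcomp Require Import all_boot.
From mathcomp Require Import zify.

(** Let [m] be the order of [G1] and [n] that of [G2].  A Hamiltonian cycle of
    [G1] and a Hamiltonian path of [G2] embed the [m] by [n] grid in the product,
    with an additional edge between the two ends of each row.  Cycles of length
    at most [m] are found in a single copy of [G1].  For the lengths above [m],
    this grid with its additional edges suffices, since [m] is odd.

    The building block ([route_comb]) is a simple grid path that joins the two
    ends of its first row.  It starts as that row itself and is lengthened by two
    vertices at a time.  The columns are grouped in pairs, leaving out the last
    one; the edge of the first row over a pair is pushed down to become a tooth
    of any depth.  The last column is then absorbed two cells at a time, by
    bumps on the vertical side of the tooth next to it ([route_bumped_tooth]).
    With [h] rows below the first one, this gives every even excess up to
    [m * h].

    - Started on row 0 and closed by the edge between the ends of that row, the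
      comb gives a cycle of every odd length from [m] to [m * n] ([has_odd_cycle]).
    - Started on row 1 and closed by row 0 run backwards, it gives every even
      length above [2 * m] up to [m * n].
    - Initial segments of rows 0 and 1, run in opposite directions, give the
      smaller even lengths (both cases are in [has_even_cycle]). *)

Set Implicit Arguments.
Unset Strict Implicit.
Unset Printing Implicit Defensive.

(** * Simple paths in the grid *)

(** The first coordinate is the column and the second one the row. *)
Definition grid : rel (nat * nat) := fun u v =>
  (u.1 == v.1) && ((u.2.+1 == v.2) || (v.2.+1 == u.2))
  || ((u.1.+1 == v.1) || (v.1.+1 == u.1)) && (u.2 == v.2).

(** The length [n] counts edges. The region [D] is recorded because, when two
    routes are joined, simplicity follows from the disjointness of regions. *)
Definition route (D : pred (nat * nat)) x y n : Prop :=
  exists p, [/\ path grid x p, last x p = y, uniq (x :: p),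
                {subset x :: p <= D} & size p = n].

Definition box i j w h : pred (nat * nat) :=
  fun u => (i <= u.1 < i + w) && (j <= u.2 < j + h).

Lemma grid_sym : symmetric grid.
Proof. by move=> [a b] [c d]; rewrite /grid /=; lia. Qed.

Lemma route_seq x p : path grid x p -> uniq (x :: p) ->
  route [in x :: p] x (last x p) (size p).
Proof. by move=> xp up; exists p; split. Qed.

Lemma route_sub (D D' : pred (nat * nat)) x y n :
  subpred D D' -> route D x y n -> route D' x y n.
Proof.
move=> sDD' [p [xp ly up pD sz]]; exists p; split=> // u /pD; exact: sDD'.
Qed.

Lemma route_join (D D1 D2 : pred (nat * nat)) x y y' z n n1 n2 :
  route D1 x y n1 -> grid y y' -> route D2 y' z n2 ->
  (forall u, D1 u -> ~~ D2 u) -> subpred D1 D -> subpred D2 D ->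
  n = (n1 + n2).+1 -> route D x z n.
Proof.
move=> [p [xp ly up pD <-]] yy' [q [yq lz uq qD <-]] dis s1 s2 ->.
exists (p ++ y' :: q); split.
- by rewrite cat_path xp ly /= yy'.
- by rewrite last_cat.
- rewrite -cat_cons cat_uniq up uq andbT.
  by apply/hasPn => u /qD uD2; apply/negP => /pD /dis/negP.
- by move=> u; rewrite -cat_cons mem_cat => /orP[/pD/s1|/qD/s2].
- by rewrite size_cat addnS.
Qed.

Lemma route_rev D x y n : route D x y n -> route D y x n.
Proof.
move=> [p [xp ly up pD sp]].
have E : y :: rev (belast x p) = rev (x :: p).
  by rewrite (lastI x p) rev_rcons ly.
exists (rev (belast x p)); split.
- rewrite -ly rev_path; apply: sub_path xp => u v.
  by rewrite grid_sym.
- have : last y (y :: rev (belast x p)) = x by rewrite E rev_cons last_rcons.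
  by [].
- by rewrite E rev_uniq.
- by rewrite E => u; rewrite mem_rev; apply: pD.
- by rewrite size_rev size_belast.
Qed.

(* Closes the side conditions of [route_join]: the step between the two routes,
   the position of the regions, and the number of edges. *)
Ltac cells :=
  first [ by rewrite /grid /=; lia
        | by rewrite /= ?inE ?xpair_eqE; lia
        | by move=> [? ?]; rewrite /= ?inE ?unfold_in /box /= ?xpair_eqE; lia ].

Lemma route_cell c : route (pred1 c) c c 0.
Proof. by exists [::]; split=> // u; rewrite inE. Qed.

Lemma route_row i j w : route (box i j w.+1 1) (i, j) (i + w, j) w.
Proof.
elim: w => [|w IH]; first by rewrite addn0; apply: route_sub (route_cell _); cells.
by apply: (route_join IH _ (route_cell _)); cells.
Qed.

(** * The comb *)

Lemma route_tooth i j d :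
  route (box i j 2 d.+1) (i, j) (i.+1, j) d.*2.+1.
Proof.
elim: d j => [|d IH] j.
  by apply: (route_join (route_cell _) _ (route_cell _)); cells.
have down : route [predD1 box i j 2 d.+2 & (i.+1, j)] (i, j) (i.+1, j.+1) d.*2.+2.
  by apply: (route_join (route_cell _) _ (IH j.+1)); cells.
by apply: (route_join down _ (route_cell _)); cells.
Qed.

(** A tooth on columns [i] and [i.+1] that also absorbs cells of column [i.+2],
    so that the three columns together can be filled up to parity. The cell
    [(i.+2, j)] stays free: it is the end of the first row of the comb, and, in
    the induction, the corner through which the next bump passes. *)
Lemma route_bumped_tooth i j h s : 2 * s <= 3 * h ->
  route [predD1 box i j 3 h.+1 & (i.+2, j)] (i, j) (i.+1, j) (2 * s).+1.
Proof.
(* For [s < 3] a plain tooth of depth [s] suffices. Otherwise two more rows are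
   put on top, with one bump over both: this adds six cells, hence the step by
   three in [s]. *)
have [k] := ubnP s; elim: k s h j => // k IH [|[|[|s]]] h j sk sh.
- by apply: (route_join (route_cell _) _ (route_cell _)); cells.
- by apply: route_sub (route_tooth i j 1); cells.
- by apply: route_sub (route_tooth i j 2); cells.
case: h sh => [|[|h]] sh; [lia | lia |].
have down : route (fun u => box i j 3 h.+3 u &&
                   ((u.1 == i) || (j.+2 <= u.2)) && (u != (i.+2, j.+2)))
                  (i, j) (i.+1, j.+2) (2 * s).+3.
  have IHs := IH s h j.+2 ltac:(lia) ltac:(lia).
  have stem := @route_seq (i, j) [:: (i, j.+1)].
  by apply: (route_join (stem _ _) _ IHs); cells.
(* From the right end of the inner tooth, out into the free corner and back. *)
have bump := @route_seq (i.+2, j.+2) [:: (i.+2, j.+1); (i.+1, j.+1); (i.+1, j)].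
by apply: (route_join down _ (bump _ _)); cells.
Qed.

(** The width is odd and at least 3, so that the columns split into [a] pairs, each
    carrying a plain tooth, and a final triple carrying a bumped one. *)
Lemma route_comb a i j h s : 2 * s <= (2 * a + 3) * h ->
  route (box i j (2 * a + 3) h.+1) (i, j) (i + (2 * a + 2), j)
        (2 * a + 2 + 2 * s).
Proof.
elim: a i s => [|a IH] i s sh.
  by apply: (route_join (@route_bumped_tooth i j h s _) _ (route_cell _)); cells.
(* Filling a pair of columns completely before going on to the next one keeps
   the remaining excess within what the remaining columns can hold. *)
have [d [ds dh sdh]] :
    exists d, [/\ d <= s, d <= h & 2 * (s - d) <= (2 * a + 3) * h].
  by exists (minn s h); split; nia.
have -> : i + (2 * a.+1 + 2) = i.+2 + (2 * a + 2) by lia.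
by apply: (route_join (route_tooth i j d) _ (IH i.+2 _ sdh)); cells.
Qed.

(** * Grid cycles in a Cartesian product *)

Lemma route_has_cycle (G : sgraph) (D : pred (nat * nat)) (f : nat * nat -> G)
    x y n :
  {in D &, injective f} ->
  {in D &, {homo f : u v / grid u v >-> adj u v}} ->
  route D x y n -> adj (f y) (f x) -> 1 < n -> has_cycle G n.+1.
Proof.
move=> f_inj f_adj [p [xp ly up pD <-]] fyx p_gt1; split=> //.
exists (map f (x :: p)); split; last by rewrite size_map.
have allD : all D (x :: p) by apply/allP.
rewrite /ucycle map_inj_in_uniq; last by move=> u v /pD uD /pD; apply: f_inj.
by rewrite up andbT /= rcons_path last_map ly fyx (homo_path_in f_adj allD).
Qed.

Lemma has_cycle_layer (G1 G2 : sgraph) k (y : G2) :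
  has_cycle G1 k -> has_cycle (cart_prod G1 G2) k.
Proof.
move=> [k3 [c [/andP[cc uc] sc]]]; split=> //.
exists [seq (x, y) | x <- c]; split; last by rewrite size_map.
rewrite /ucycle map_inj_uniq ?uc ?andbT => [|? ? [] //].
apply: homo_cycle cc => u v uv.
by rewrite /= /cart_adj /= uv eqxx orbT.
Qed.

(** [x :: w] stands for a Hamiltonian cycle of the first factor, cut open at [x],
    and [y :: q] for a Hamiltonian path of the second one. *)
Section Embedding.

Variables (G1 G2 : sgraph) (x : G1) (w : seq G1) (y : G2) (q : seq G2).
Hypotheses (xw : path (@adj G1) x w) (uw : uniq (x :: w)).
Hypotheses (yq : path (@adj G2) y q) (uq : uniq (y :: q)).

Definition embed (u : nat * nat) : cart_prod G1 G2 :=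
  (nth x (x :: w) u.1, nth y (y :: q) u.2).

Let embedded := box 0 0 (size w).+1 (size q).+1.

Lemma embed_inj : {in embedded &, injective embed}.
Proof.
move=> [a b] [c d]; rewrite !unfold_in /box /= => ab cd [/eqP ac /eqP bd].
move: ac bd; rewrite (nth_uniq x) ?(nth_uniq y) //=; try lia.
by move=> /eqP -> /eqP ->.
Qed.

Lemma embed_adj : {in embedded &, {homo embed : u v / grid u v >-> adj u v}}.
Proof.
have step1 := pathP x xw; have step2 := pathP y yq.
move=> [a b] [c d]; rewrite !unfold_in /box /= /grid /cart_adj /= => ab cd.
case/orP=> /andP[].
- move=> /eqP <-; rewrite eqxx /= => /orP[]/eqP E; apply/orP; left; subst.
    by apply: step2; lia.
  by rewrite adj_sym; apply: step2; lia.
- move=> E /eqP <-; rewrite eqxx andbT; apply/orP; right.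
  case/orP: E => /eqP E; subst; first by apply: step1; lia.
  by rewrite adj_sym; apply: step1; lia.
Qed.

(** The edge that closes the comb joins the two ends of row 0: it comes from the
    Hamiltonian cycle of [G1] and is not an edge of the grid. *)
Lemma has_odd_cycle a s :
  adj (last x w) x -> size w = 2 * a + 2 -> 2 * s <= (2 * a + 3) * size q ->
  has_cycle (cart_prod G1 G2) (2 * a + 3 + 2 * s).
Proof.
move=> wx sw sq; have comb := route_comb 0 0 sq.
have -> : 2 * a + 3 + 2 * s = (2 * a + 2 + 2 * s).+1 by lia.
apply: (route_has_cycle embed_inj embed_adj) => //; last by lia.
  by apply: route_sub comb; rewrite /embedded sw; cells.
rewrite /= /cart_adj /embed /= add0n -sw -[size w]/(size (x :: w)).-1.
by rewrite nth_last /= wx eqxx orbT.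
Qed.

Lemma has_even_cycle a l :
  size w = 2 * a + 2 -> 0 < size q -> 2 <= l ->
  2 * l <= (size w).+1 * (size q).+1 ->
  has_cycle (cart_prod G1 G2) (2 * l).
Proof.
move=> sw q0 l2 lmn.
(* A route that avoids row 0 is closed by running back along row 0. *)
have close t n : t <= size w -> 0 < t ->
    route (fun u => embedded u && (0 < u.2)) (0, 1) (t, 1) n ->
    has_cycle (cart_prod G1 G2) (n + t + 2).
  move=> tw t0 top.
  have := route_row 0 0 t; rewrite add0n => /route_rev bottom.
  have loop : route embedded (0, 1) (0, 0) (n + t).+1.
    by apply: (route_join top _ bottom); rewrite /embedded; cells.
  rewrite addn2; apply: (route_has_cycle embed_inj embed_adj loop); last by lia.
  by apply: embed_adj; rewrite ?unfold_in /embedded /box /grid //=; lia.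
have [small|big] := leqP l (size w).+1.
  have -> : 2 * l = l.-1 + l.-1 + 2 by lia.
  apply: close; try lia.
  by apply: route_sub (route_row 0 1 l.-1); rewrite /embedded; cells.
have -> : 2 * l = 2 * a + 2 + 2 * (l - size w - 1) + size w + 2 by lia.
apply: close; try lia.
rewrite sw; apply: route_sub (@route_comb a 0 1 (size q).-1 _ _).
  by rewrite /embedded; cells.
by nia.
Qed.

End Embedding.

Theorem theorem1p3 (G1 G2 : sgraph)
  (G1_pancyclic : pancyclic G1) (G1_odd : odd (graph_order G1))
  (G2_semi_hamiltonian : semi_hamiltonian G2) :
  pancyclic (cart_prod G1 G2).
Proof.
have [m3 cyc1] := G1_pancyclic.
have [y [q [yq uq sq]]] := G2_semi_hamiltonian.
have mn : graph_order (cart_prod G1 G2) = graph_order G1 * graph_order G2.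
  exact: card_prod.
split=> [|k]; first by rewrite mn -sq /=; nia.
rewrite mn => /andP[k3 kmn].
have [km|km] := leqP k (graph_order G1).
  by apply: has_cycle_layer => //; apply: cyc1; rewrite k3.
have [_ [[|x w] [/andP[cw uw] sw]]] := cyc1 (graph_order G1) ltac:(lia).
  by move: m3; rewrite -sw.
move: cw; rewrite /= rcons_path => /andP[xw wx].
rewrite -sw -sq /= in m3 G1_odd km kmn.
have [a wa] : exists a, size w = 2 * a + 2 by exists (size w - 2)./2; lia.
have := odd_double_half k; case: (odd k) => kE.
  have E : k = 2 * a + 3 + 2 * (k./2 - a - 1) by lia.
  by rewrite E; apply: (has_odd_cycle xw uw yq uq wx wa); nia.
have E : k = 2 * k./2 by lia.
by rewrite E; apply: (has_even_cycle xw uw yq uq wa); nia.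
Qed.
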